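(* Let $H:\mathbb{R}^{2m}\to\mathbb{R}$ be smooth, let $\bar\nabla_sH$ be a (continuously differentiable) symmetric discrete gradient of $H$, and let $\bar y\in\mathbb{R}^{2m}$. The following modification of the symmetric discrete gradient scheme is locally exact at $\bar y$: $$y_{n+1}-y_n=\theta_n\,S\,\bar\nabla_sH(y_n,y_{n+1}),\qquad \theta_n=2(F')^{-1}\tanh\frac{h_nF'}{2},$$ where $F'=S\,H_{yy}$ is evaluated at $y=\bar y$, and $h_n>0$ is sufficiently small that $\tanh\frac{h_nF'}{2}$ is defined.
   Context: Hamiltonian system: $y=(x,p)^T$, $x,p\in\mathbb{R}^m$, $\dot x^k=\partial H/\partial p^k$, $\dot p^k=-\partial H/\partial x^k$ ($k=1,\dots,m$), i.e. $\dot y=F(y)$ with $F=S H_y$, where $S=\begin{pmatrix}0&I\\-I&0\end{pmatrix}$, $H_y$ is the gradient (column vector) and $H_{yy}$ the Hessian of $H$; $F'=SH_{yy}$ is the Jacobi matrix of $F$. The expression $2(F')^{-1}\tanh\frac{h_nF'}{2}$ is understood as $h_n\operatorname{tanhc}\frac{h_nF'}{2}$ with $\operatorname{tanhc}(z)=z^{-1}\tanh z$, $\operatorname{tanhc}(0)=1$, so it makes sense also for singular $F'$. Discrete gradient: a function $\bar\nabla H(y_n,y_{n+1})\in\mathbb{R}^{2m}$ (treated as a column vector) such that $\langle\bar\nabla H(y_n,y_{n+1}),\,y_{n+1}-y_n\rangle=H(y_{n+1})-H(y_n)$ and $\bar\nabla H(y,y)=H_y(y)$ (the latter value being defined as the limit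 $\lim_{\tilde y\to y}\bar\nabla H(y,\tilde y)$ when necessary). The symmetric discrete gradient related to a discrete gradient $\bar\nabla H$ is $\bar\nabla_sH(y_n,y_{n+1})=\frac12\bigl(\bar\nabla H(y_n,y_{n+1})+\bar\nabla H(y_{n+1},y_n)\bigr)$. The (unmodified) discrete gradient scheme is $y_{n+1}-y_n=h_nS\,\bar\nabla_sH$. Local exactness at $\bar y$: substitute $y_n=\bar y+\nu_n$, $y_{n+1}=\bar y+\nu_{n+1}$ into the scheme (with $\bar y$, hence $\theta_n$, held fixed) and keep only terms of order at most one in $(\nu_n,\nu_{n+1})$; the scheme is locally exact at $\bar y$ if the resulting linear difference equation, solved for $\nu_{n+1}$, is identical with $\nu_{n+1}=e^{h_nF'}\nu_n+h_n\varphi_1(h_nF')F$ ($F,F'$ evaluated at $\bar y$, $\varphi_1(z)=(e^z-1)/z$, $\varphi_1(0)=1$), which is the exact discretization of the linearized equation $\dot\nu=F'\nu+F$. *)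

(* Defs.v *)
From HB Require Import structures.
From mathcomp Require Import all_boot all_order all_algebra.
From mathcomp Require Import all_classical all_reals all_analysis.
Set Implicit Arguments.
Unset Strict Implicit.
Unset Printing Implicit Defensive.
Import Order.TTheory GRing.Theory Num.Theory.
Import numFieldNormedType.Exports.
Local Open Scope classical_set_scope.
Local Open Scope ring_scope.

Section Calculus.
Context {R : realType}.

Definition partial n (f : 'cV[R]_n -> R) (i : 'I_n) (y : 'cV[R]_n) : R :=
  'D_(delta_mx i 0) f y.

Fixpoint iter_partial n (f : 'cV[R]_n -> R) (s : seq 'I_n) : 'cV[R]_n -> R :=
  if s is i :: s' then partial (iter_partial f s') i else f.

(* C^oo: the partial derivatives of every order exist and are themselves
   (Frechet) differentiable, hence continuous. *)
Definition smooth n (f : 'cV[R]_n -> R) : Prop :=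
  forall (s : seq 'I_n) (y : 'cV[R]_n), differentiable (iter_partial f s) y.

(* Used in finite dimension, where pointwise continuity of [x |-> 'd f x v]
   for each [v] is continuity of [x |-> 'd f x] in operator norm. *)
Definition C1 (V W : normedModType R) (f : V -> W) : Prop :=
  (forall x, differentiable f x) /\
  (forall v, continuous (fun x => 'd f x v)).

Definition gradient n (f : 'cV[R]_n -> R) (y : 'cV[R]_n) : 'cV[R]_n :=
  \col_i partial f i y.

Definition hessian n (f : 'cV[R]_n -> R) (y : 'cV[R]_n) : 'M[R]_n :=
  \matrix_(i, j) partial (partial f i) j y.

(* Column convention: [jacobi_mx F y] acts on the left of column vectors; it is
   the transpose of the convention of ['J F y] in mathcomp-analysis. *)
Definition jacobi_mx n (F : 'cV[R]_n -> 'cV[R]_n) (y : 'cV[R]_n) : 'M[R]_n :=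
  \matrix_(i, j) partial (fun z => F z i 0) j y.

End Calculus.

Section MatrixFunctions.
Context {R : realType}.

Definition mx_pser n (c : nat -> R) (X : 'M[R]_n) : 'M[R]_n :=
  limn (series (fun k => c k *: X ^+ k)).

Definition mx_exp n (X : 'M[R]_n) := mx_pser (fun k => (k`!)%:R^-1) X.

(* (e^z - 1) / z *)
Definition mx_phi1 n (X : 'M[R]_n) := mx_pser (fun k => (k.+1`!)%:R^-1) X.

Definition mx_cosh n (X : 'M[R]_n) :=
  mx_pser (fun k => (~~ odd k)%:R / (k`!)%:R) X.

(* sinh z / z, with value 1 at 0 *)
Definition mx_sinhc n (X : 'M[R]_n) :=
  mx_pser (fun k => (~~ odd k)%:R / (k.+1`!)%:R) X.

(* tanhc z = tanh z / z = (sinh z / z) / cosh z is analytic away from the zeros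
   of cosh, so that tanh X and tanhc X are defined exactly when no eigenvalue of
   X is a zero of cosh, that is, when mx_cosh X is invertible. *)
Definition mx_tanh_defined n (X : 'M[R]_n) : Prop := mx_cosh X \in unitmx.

Definition mx_tanhc n (X : 'M[R]_n) : 'M[R]_n :=
  mx_sinhc X *m invmx (mx_cosh X).

End MatrixFunctions.

Section Hamiltonian.
Context {R : realType} {m : nat}.

Definition symp_mx : 'M[R]_(m + m) :=
  block_mx 0 1%:M (- 1%:M) 0.

Definition ham_field (H : 'cV[R]_(m + m) -> R) (y : 'cV[R]_(m + m)) :
    'cV[R]_(m + m) :=
  symp_mx *m gradient H y.

Definition ham_jacobi (H : 'cV[R]_(m + m) -> R) (y : 'cV[R]_(m + m)) :
    'M[R]_(m + m) :=
  symp_mx *m hessian H y.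

End Hamiltonian.

Section DiscreteGradient.
Context {R : realType} {n : nat}.
Implicit Types (H : 'cV[R]_n -> R) (dg : 'cV[R]_n -> 'cV[R]_n -> 'cV[R]_n).

(* [dg] is total: where the defining formula of a discrete gradient is
   singular, its value is the one obtained by passing to the limit. *)
Definition is_discrete_gradient H dg : Prop :=
  (forall y y' : 'cV[R]_n,
     \sum_(i < n) dg y y' i 0 * (y' - y) i 0 = H y' - H y) /\
  (forall y : 'cV[R]_n, dg y y = gradient H y).

Definition sym_dgrad dg (y y' : 'cV[R]_n) : 'cV[R]_n :=
  2^-1 *: (dg y y' + dg y' y).

End DiscreteGradient.

Section Schemes.
Context {R : realType}.

(* A one-step scheme is given by its residual [Phi]: the equation relating
   y_n and y_{n+1} is [Phi (y_n, y_{n+1}) = 0]. *)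

(* The residual at (ybar + nu, ybar + nu'), up to terms of order one in
   (nu, nu'). *)
Definition linearized n (Phi : 'cV[R]_n * 'cV[R]_n -> 'cV[R]_n)
    (ybar nu nu' : 'cV[R]_n) : 'cV[R]_n :=
  Phi (ybar, ybar) + 'd Phi (ybar, ybar) (nu, nu').

(* The equivalence says that the linearized equation is uniquely solvable for
   nu' and that its solution is the exact discretization, with step h, of
   dnu/dt = F' nu + F, where F and F' are evaluated at ybar. *)
Definition locally_exact n (F : 'cV[R]_n -> 'cV[R]_n) (h : R)
    (Phi : 'cV[R]_n * 'cV[R]_n -> 'cV[R]_n) (ybar : 'cV[R]_n) : Prop :=
  let F' := jacobi_mx F ybar in
  differentiable Phi (ybar, ybar) /\
  forall nu nu' : 'cV[R]_n,
    linearized Phi ybar nu nu' = 0 <->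
    nu' = mx_exp (h *: F') *m nu + h *: (mx_phi1 (h *: F') *m F ybar).

(* y_{n+1} - y_n = theta S dgs(y_n, y_{n+1}); [theta] does not depend on y_n and
   y_{n+1}. *)
Definition dgrad_scheme m (theta : 'M[R]_(m + m))
    (dgs : 'cV[R]_(m + m) -> 'cV[R]_(m + m) -> 'cV[R]_(m + m))
    (y : 'cV[R]_(m + m) * 'cV[R]_(m + m)) : 'cV[R]_(m + m) :=
  y.2 - y.1 - theta *m symp_mx *m dgs y.1 y.2.

(* 2 F'^-1 tanh(h F' / 2), in the form that makes sense for singular F' *)
Definition theta_sym n (h : R) (F' : 'M[R]_n) : 'M[R]_n :=
  h *: mx_tanhc ((h / 2) *: F').

End Schemes.

(* Main.v *)
Require Import Defs.
From HB Require Import structures.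
From mathcomp Require Import all_boot all_order all_algebra.
From mathcomp Require Import all_classical all_reals all_analysis.
From mathcomp Require Import zify ring.
Import Order.TTheory GRing.Theory Num.Theory.
Import numFieldNormedType.Exports.
Local Open Scope classical_set_scope.
Local Open Scope ring_scope.

Set Implicit Arguments.
Unset Strict Implicit.
Unset Printing Implicit Defensive.

(** Write X = h F' / 2. The proof splits into a differential part and an
    algebraic part.

    Differential part. A symmetric map G of two variables has equal partial
    derivatives on the diagonal, so its differential at (p, p) is
    (u, v) |-> g'(p) (u + v) / 2, where g(x) = G(x, x) ([diff_symmetric]).
    The symmetric discrete gradient restricted to the diagonal is the gradient
    of H, whose differential is the Hessian. Hence the linearized scheme reads
      nu' - nu = tanhc(X) (h F + X (nu + nu')),
    an implicit midpoint rule for the linearized equation, in which the matrix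
    h tanhc(X) replaces the step h.

    Algebraic part. Since tanhc = sinhc / cosh, multiplying by cosh X gives
      (cosh X - X sinhc X) nu' = (cosh X + X sinhc X) nu + h sinhc(X) F,
    that is, exp(-X) nu' = exp(X) nu + h sinhc(X) F; multiplying by exp X yields
      nu' = exp(2 X) nu + h exp(X) sinhc(X) F,
    and exp(X) sinhc(X) = phi1(2 X) because e^z sinh z = (e^(2 z) - 1) / 2.
    Each step is reversible, so the linearized equation is equivalent to the
    exact discretization ([solve_tanhc_midpoint]).

    As X may be singular, the last identity cannot be obtained by dividing by X.
    The matrix identities are therefore reduced to identities between sequences
    of coefficients: the product of two everywhere convergent matrix power series
    is the series of the Cauchy product of the coefficients ([mx_pser_mul]), and
    the Cauchy products that occur follow from the binomial theorem
    ([cauchy_prod_exp]). *)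

(** * Entrywise convergence of matrices *)

Lemma cvg_mxP (R : realType) (T : Type) (F : set_system T) {FF : Filter F}
    m n (u : T -> 'M[R]_(m, n)) (l : 'M[R]_(m, n)) :
  u @ F --> l <-> forall i j, (fun x => u x i j) @ F --> l i j.
Proof.
split=> [ul i j|ul].
  apply: (@cvg_comp _ _ _ u (fun M : 'M[R]_(m, n) => M i j) _ _ _ ul).
  exact: coord_continuous.
apply/cvg_ballP => e e0.
suff : \forall x \near F, forall ij : 'I_m * 'I_n,
    ball (l ij.1 ij.2) e (u x ij.1 ij.2).
  by apply: filterS => x ux; split=> // i j; exact: (ux (i, j)).
apply: filter_forall => -[i j].
by have /cvg_ballP := ul i j; exact.
Qed.

Lemma cvg_mulmx (R : realType) (T : Type) (F : set_system T) {FF : Filter F}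
    m n p (u : T -> 'M[R]_(m, n)) (v : T -> 'M[R]_(n, p))
    (a : 'M[R]_(m, n)) (b : 'M[R]_(n, p)) :
  u @ F --> a -> v @ F --> b -> (fun x => u x *m v x) @ F --> a *m b.
Proof.
move=> /cvg_mxP ua /cvg_mxP vb; apply/cvg_mxP => i j.
rewrite mxE; under eq_fun do rewrite mxE.
by apply: cvg_big => [|k _]; [exact: add_continuous|exact: cvgM].
Qed.

(** The sum of all absolute values of entries dominates every row sum, so that
    one real number controls all powers entrywise; this reduces the convergence
    of matrix power series to that of real series. *)
Lemma mx_expr_bound (R : realType) n (X : 'M[R]_n) :
  exists2 r : R, 0 <= r & forall k i j, `|(X ^+ k) i j| <= r ^+ k.
Proof.
pose r := \sum_i \sum_j `|X i j|.
have r0 : 0 <= r by apply: sumr_ge0 => i _; exact: sumr_ge0.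
exists r => //; elim=> [|k IHk] i j.
  by rewrite !expr0 mxE; case: (_ == _); rewrite /= ?normr1 ?normr0.
rewrite !exprS mxE (le_trans (ler_norm_sum _ _ _))//.
rewrite (@le_trans _ _ (\sum_l `|X i l| * r ^+ k))//.
  by apply: ler_sum => l _; rewrite normrM ler_wpM2l.
rewrite -mulr_suml ler_wpM2r ?exprn_ge0// /r [leRHS](bigD1 i)//= lerDl.
by apply: sumr_ge0 => ? _; exact: sumr_ge0.
Qed.

(** * Matrix power series and their products *)

Definition entire (R : realType) (c : nat -> R) : Prop :=
  forall r : R, 0 <= r -> cvgn (series (fun k => `|c k| * r ^+ k)).

Lemma entire_le_fact (R : realType) (c : nat -> R) :
  (forall k, `|c k| <= (k`!)%:R^-1) -> entire c.
Proof.
move=> ck r r0; apply: series_le_cvg (is_cvg_series_exp_coeff r).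
- by move=> k; rewrite mulr_ge0 ?exprn_ge0.
- by move=> k; exact: exp_coeff_ge0.
- by move=> k; rewrite exp_coeffE ler_wpM2r ?exprn_ge0.
Qed.

Lemma cvg_mx_pser (R : realType) n (c : nat -> R) (X : 'M[R]_n) :
  entire c -> series (fun k => c k *: X ^+ k) @ \oo --> mx_pser c X.
Proof.
move=> cE; have [r r0 Xr] := mx_expr_bound X.
suff : cvgn (series (fun k => c k *: X ^+ k)) by [].
pose l := \matrix_(i, j) limn (series (fun k => c k * (X ^+ k) i j)).
apply/cvg_ex; exists l; apply/cvg_mxP => i j; rewrite mxE.
under eq_fun => k.
  rewrite /series/= summxE; under eq_bigr do rewrite mxE.
  over.
suff : cvgn (series (fun k => c k * (X ^+ k) i j)) by [].
apply: normed_cvg; apply: series_le_cvg (cE r r0) => k //=.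
  by rewrite mulr_ge0 ?exprn_ge0.
by rewrite normrM ler_wpM2l.
Qed.

Definition cauchy_prod (R : realType) (c d : nat -> R) (k : nat) : R :=
  \sum_(0 <= i < k.+1) c i * d (k - i)%N.

Lemma triangle_sum (V : zmodType) (f : nat -> nat -> V) N :
  \sum_(0 <= k < N) \sum_(0 <= i < k.+1) f i (k - i)%N =
  \sum_(0 <= i < N) \sum_(0 <= j < N - i) f i j.
Proof.
elim: N => [|N IHN]; first by rewrite !big_nil.
rewrite big_nat_recr//= IHN [RHS]big_nat_recr//= [X in _ + X]big_nat_recr//=.
rewrite subSnn subnn big_nat1 addrA -big_split/=; congr (_ + _).
apply: eq_big_nat => i /andP[_ iN].
by rewrite subSn ?(ltnW iN)// [RHS]big_nat_recr.
Qed.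

(** Subtracting the partial sum of a Cauchy product, a sum over a triangle,
    from the product of the partial sums, a sum over a square, leaves the
    corner where the two indices add up to at least N. *)
Lemma corner_sum (V : zmodType) (f : nat -> nat -> V) N :
  \sum_(0 <= i < N) \sum_(0 <= j < N) f i j -
    \sum_(0 <= k < N) \sum_(0 <= i < k.+1) f i (k - i)%N =
  \sum_(0 <= i < N) \sum_(N - i <= j < N) f i j.
Proof.
rewrite triangle_sum -sumrB; apply: eq_big_nat => i /andP[_ iN].
rewrite (big_cat_nat (leq0n _) (leq_subr i N))/=.
by rewrite addrAC subrr add0r.
Qed.

(** The triangle i + j < N contains the square i, j < N / 2, so the corner is at
    most the difference of the products of partial sums at N and at N / 2, both
    of which converge to the same limit. *)
Lemma cvg_corner_sum (R : realType) (a b : nat -> R) :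
    (forall k, 0 <= a k) -> (forall k, 0 <= b k) ->
    cvgn (series a) -> cvgn (series b) ->
  (fun N => \sum_(0 <= i < N) \sum_(N - i <= j < N) a i * b j) @ \oo --> 0.
Proof.
move=> a0 b0 ca cb; pose l := limn (series a) * limn (series b).
have abl : series a \* series b @ \oo --> l by apply: cvgM.
have half_oo : half @ \oo --> \oo.
  move=> A [N _ NA]; exists N.*2 => // k /=; rewrite -geq_half_double.
  exact: NA.
have E : (fun N => (series a \* series b) N - (series a \* series b) N./2)
    @ \oo --> 0.
  rewrite -(subrr l); apply: cvgB => //.
  exact: (@cvg_comp _ _ _ half (series a \* series b) _ _ _ half_oo abl).
apply: squeeze_cvgr (cvg_cst 0) E; apply: nearW => N.
apply/andP; split.
  by do 2 (apply: sumr_ge0 => ? _); rewrite mulr_ge0.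
rewrite -corner_sum /= /series/= big_distrlr/= lerD2l lerN2 big_distrlr/=.
rewrite (triangle_sum (fun i j => a i * b j)).
have hN : (N./2 <= N)%N by rewrite leq_half_double -addnn -addnS leq_addr.
rewrite [leRHS](big_cat_nat (leq0n _) hN)/=.
rewrite -[leLHS]addr0 lerD//; last first.
  by do 2 (apply: sumr_ge0 => ? _); rewrite mulr_ge0.
apply: ler_sum_nat => i /andP[_ iN].
have hNi : (N./2 <= N - i)%N.
  by rewrite leq_subRL; lia.
rewrite [leRHS](big_cat_nat (leq0n _) hNi)/= lerDl.
by apply: sumr_ge0 => ? _; rewrite mulr_ge0.
Qed.

Lemma mx_pser_lim (R : realType) n (c : nat -> R) (X l : 'M[R]_n)
    (u : nat -> 'M[R]_n) :
  (forall N, u N = series (fun k => c k *: X ^+ k) N) -> u @ \oo --> l ->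
  mx_pser c X = l.
Proof. by move=> uE ul; apply: cvg_lim => //; rewrite -(funext uE). Qed.

(** Mertens-type theorem: the difference between the product of the partial sums
    and the partial sum of the Cauchy product is a corner sum of matrices, which
    is dominated entrywise by the corner sum of the absolute series. *)
Lemma mx_pser_mul (R : realType) n (c d : nat -> R) (X : 'M[R]_n) :
    entire c -> entire d ->
  mx_pser c X *m mx_pser d X = mx_pser (cauchy_prod c d) X.
Proof.
move=> cE dE; have [r r0 Xr] := mx_expr_bound X.
pose u e : nat -> 'M[R]_n := series (fun k => e k *: X ^+ k).
pose f i j := (c i *: X ^+ i) *m (d j *: X ^+ j).
have fE i j : f i j = (c i * d j) *: X ^+ (i + j).
  by rewrite /f -scalemxAl -scalemxAr scalerA exprD.
have convE N : u (cauchy_prod c d) N =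
    \sum_(0 <= k < N) \sum_(0 <= i < k.+1) f i (k - i)%N.
  apply: eq_big_nat => k _; rewrite scaler_suml; apply: eq_big_nat => i.
  by rewrite ltnS => /andP[_ ik]; rewrite fE subnKC.
have cd : (fun N => u c N *m u d N) @ \oo --> mx_pser c X *m mx_pser d X.
  by apply: cvg_mulmx; exact: cvg_mx_pser.
have cornerE : (fun N => u c N *m u d N - u (cauchy_prod c d) N) =
    (fun N => \sum_(0 <= i < N) \sum_(N - i <= j < N) f i j).
  apply/funext => N; rewrite convE -corner_sum; congr (_ - _).
  rewrite mulmx_suml; apply: eq_bigr => i _; exact: mulmx_sumr.
have corner0 : (fun N => u c N *m u d N - u (cauchy_prod c d) N) @ \oo -->
    (0 : 'M[R]_n).
  rewrite cornerE; apply/cvg_mxP => i j; rewrite mxE; apply: norm_cvg0.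
  have a0 k : 0 <= `|c k| * r ^+ k by rewrite mulr_ge0 ?exprn_ge0.
  have b0 k : 0 <= `|d k| * r ^+ k by rewrite mulr_ge0 ?exprn_ge0.
  apply: squeeze_cvgr (cvg_cst 0) (cvg_corner_sum a0 b0 (cE r r0) (dE r r0)).
  apply: nearW => N; rewrite normr_ge0 summxE/=.
  rewrite (le_trans (ler_norm_sum _ _ _))//; apply: ler_sum => p _.
  rewrite summxE (le_trans (ler_norm_sum _ _ _))//; apply: ler_sum => q _.
  by rewrite fE mxE !normrM mulrACA -exprD ler_wpM2l.
rewrite -[LHS]subr0; apply/esym; apply: (mx_pser_lim _ (cvgB cd corner0)) => N.
by rewrite /= subKr.
Qed.

Lemma cauchy_prodC (R : realType) (c d : nat -> R) :
  cauchy_prod c d = cauchy_prod d c.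
Proof.
apply/funext => k; rewrite /cauchy_prod big_nat_rev/=; apply: eq_big_nat => i.
by rewrite ltnS => /andP[_ ik]; rewrite add0n subSS subKn// mulrC.
Qed.

Lemma mx_pser_comm (R : realType) n (c d : nat -> R) (X : 'M[R]_n) :
  entire c -> entire d ->
  mx_pser c X *m mx_pser d X = mx_pser d X *m mx_pser c X.
Proof. by move=> cE dE; rewrite !mx_pser_mul// cauchy_prodC. Qed.

Lemma mx_pserZ (R : realType) n (c : nat -> R) a (X : 'M[R]_n) :
  mx_pser c (a *: X) = mx_pser (fun k => a ^+ k * c k) X.
Proof.
rewrite /mx_pser; congr (limn (series _)); apply/funext => k.
have -> : (a *: X) ^+ k = a ^+ k *: X ^+ k.
  elim: k => [|k IHk]; first by rewrite !expr0 scale1r.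
  rewrite [in LHS]exprS IHk -[_ * _]/(_ *m _) -scalemxAl -scalemxAr scalerA.
  by rewrite -exprS -[_ *m _]/(_ * _) -exprS.
by rewrite scalerA mulrC.
Qed.

Lemma mx_pser_linear (R : realType) n (c d : nat -> R) a (X : 'M[R]_n) :
    entire c -> entire d ->
  mx_pser c X + a *: mx_pser d X = mx_pser (fun k => c k + a * d k) X.
Proof.
move=> cE dE; apply/esym.
have dX := cvgZl_tmp (k := a) (cvg_mx_pser (X := X) dE).
pose u e : nat -> 'M[R]_n := series (fun k => e k *: X ^+ k).
have cdX : (fun N => u c N + a *: u d N) @ \oo -->
    mx_pser c X + a *: mx_pser d X.
  by apply: cvgD; [exact: cvg_mx_pser|exact: dX].
apply: (mx_pser_lim _ cdX) => N.
rewrite /= /series/= scaler_sumr -big_split/=.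
by apply: eq_bigr => k _; rewrite scalerDl scalerA.
Qed.

(** For series whose coefficient of index 0 is special: the partial sums are
    compared from the second one on. *)
Lemma mx_pser_lim_shift (R : realType) n (c : nat -> R) (X l : 'M[R]_n)
    (u : nat -> 'M[R]_n) :
    (forall N, u N = series (fun k => c k *: X ^+ k) N.+1) -> u @ \oo --> l ->
  mx_pser c X = l.
Proof.
by move=> uE ul; apply: cvg_lim => //; rewrite -cvg_shiftS -(funext uE).
Qed.

Lemma mx_pser1 (R : realType) n (X : 'M[R]_n) :
  mx_pser (fun k => (k == 0)%:R) X = 1%:M.
Proof.
apply: (mx_pser_lim_shift _ (cvg_cst (1%:M : 'M[R]_n))) => N.
rewrite /series/= big_nat_recl//= big1 ?addr0 ?scale1r// => i _.
by rewrite scale0r.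
Qed.

Lemma mx_pserX (R : realType) n (c : nat -> R) (X : 'M[R]_n) : entire c ->
  X *m mx_pser c X = mx_pser (fun k => if k is k'.+1 then c k' else 0) X.
Proof.
move=> cE; apply/esym.
apply: (mx_pser_lim_shift _
  (cvg_mulmx (cvg_cst X) (cvg_mx_pser (X := X) cE))) => N.
rewrite /series/= big_nat_recl//= scale0r add0r mulmx_sumr.
by apply: eq_bigr => k _; rewrite -scalemxAr exprS.
Qed.

Lemma mx_pser_commX (R : realType) n (c : nat -> R) (X : 'M[R]_n) : entire c ->
  mx_pser c X *m X = X *m mx_pser c X.
Proof.
move=> cE; rewrite (mx_pserX X cE); apply/esym.
apply: (mx_pser_lim_shift _
  (cvg_mulmx (cvg_mx_pser (X := X) cE) (cvg_cst X))) => N.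
rewrite /series/= big_nat_recl//= scale0r add0r mulmx_suml.
by apply: eq_bigr => k _; rewrite -scalemxAl exprSr.
Qed.

(** * Identities between exp, cosh, sinhc and phi1 *)

Definition exp_coef (R : realType) (x : R) k : R := x ^+ k / k`!%:R.

(** This is the binomial theorem divided by k!. *)
Lemma cauchy_prod_exp (R : realType) (x y : R) :
  cauchy_prod (exp_coef x) (exp_coef y) = exp_coef (x + y).
Proof.
apply/funext => k; rewrite /cauchy_prod /exp_coef addrC exprDn mulr_suml.
rewrite big_mkord; apply: eq_bigr => i _.
have ik : (i <= k)%N by rewrite -ltnS.
have fact_neq0 j : j`!%:R != 0 :> R by rewrite pnatr_eq0 -lt0n fact_gt0.
rewrite -mulr_natr -(bin_fact ik) !natrM.
have binN0 : ('C(k, i))%:R != 0 :> R by rewrite pnatr_eq0 -lt0n bin_gt0.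
by field; rewrite binN0 !fact_neq0.
Qed.

Lemma mx_expE (R : realType) n a (X : 'M[R]_n) :
  mx_exp (a *: X) = mx_pser (exp_coef a) X.
Proof. exact: mx_pserZ. Qed.

Lemma entire_exp_coef (R : realType) (s : R) : entire (exp_coef s).
Proof.
move=> r r0; have <- : exp_coeff (`|s| * r) = fun k => `|exp_coef s k| * r ^+ k.
  apply/funext => k; rewrite exp_coeffE exprMn.
  by rewrite /exp_coef normrM normrX normfV normr_nat; ring.
exact: is_cvg_series_exp_coeff.
Qed.

Definition cosh_coef (R : realType) k : R := (~~ odd k)%:R / k`!%:R.
Definition sinhc_coef (R : realType) k : R := (~~ odd k)%:R / k.+1`!%:R.
Definition sinh_coef (R : realType) k : R := (odd k)%:R / k`!%:R.

Lemma norm_bool_mul_le (R : realType) (b : bool) (x y : R) :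
  0 <= x -> x <= y -> `|b%:R * x| <= y.
Proof.
by case: b => x0 xy; rewrite ?mul0r ?mul1r ?normr0 ?ger0_norm// (le_trans x0).
Qed.

Lemma entire_cosh (R : realType) : entire (@cosh_coef R).
Proof. by apply: entire_le_fact => k; rewrite norm_bool_mul_le ?invr_ge0. Qed.

Lemma entire_sinh (R : realType) : entire (@sinh_coef R).
Proof. by apply: entire_le_fact => k; rewrite norm_bool_mul_le ?invr_ge0. Qed.

Lemma entire_sinhc (R : realType) : entire (@sinhc_coef R).
Proof.
apply: entire_le_fact => k; rewrite norm_bool_mul_le ?invr_ge0//.
by rewrite lef_pV2 ?posrE ?ltr0n ?fact_gt0// ler_nat factS leq_pmull.
Qed.

(** The boolean is a sign: the two cases are cosh z + sinh z = e^z and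
    cosh z - sinh z = e^(-z). *)
Lemma cosh_addr_sinh (R : realType) (b : bool) :
  (fun k => cosh_coef R k + (-1) ^+ b * sinh_coef R k) = exp_coef ((-1) ^+ b).
Proof.
apply/funext => k; rewrite /cosh_coef /sinh_coef /exp_coef mulrA -mulrDl.
congr (_ / _); rewrite -exprM mulnC exprM -(signr_odd _ k).
by case: b; case: odd; rewrite /= ?expr0 ?expr1; ring.
Qed.

Lemma mx_cosh_add_sinh (R : realType) n (X : 'M[R]_n) (b : bool) :
  mx_cosh X + (-1) ^+ b *: (X *m mx_sinhc X) = mx_exp ((-1) ^+ b *: X).
Proof.
have -> : X *m mx_sinhc X = mx_pser (@sinh_coef R) X.
  rewrite (mx_pserX X (@entire_sinhc R)); congr (mx_pser _ X).
  apply/funext => -[|k]; first by rewrite /sinh_coef mul0r.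
  by rewrite /sinh_coef /sinhc_coef/=.
rewrite mx_expE -cosh_addr_sinh; apply: mx_pser_linear.
  exact: entire_cosh.
exact: entire_sinh.
Qed.

Lemma mx_expM (R : realType) n (X : 'M[R]_n) (s t : R) :
  mx_exp (s *: X) *m mx_exp (t *: X) = mx_exp ((s + t) *: X).
Proof.
by rewrite !mx_expE mx_pser_mul ?cauchy_prod_exp//; exact: entire_exp_coef.
Qed.

Lemma mx_exp0 (R : realType) n (X : 'M[R]_n) : mx_exp (0 *: X) = 1%:M.
Proof.
rewrite mx_expE -(mx_pser1 X); congr (mx_pser _ X); apply/funext => -[|k].
  by rewrite /exp_coef expr0 divr1.
by rewrite /exp_coef expr0n mul0r.
Qed.

(** The coefficients of e^z (sinh z / z) = (e^(2 z) - 1) / (2 z). The k-th one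
    of the left-hand side is, up to the factor 1/2, the coefficient of index
    k + 1 of e^z e^z - e^z e^(-z); the term of index k + 1 that completes this
    Cauchy product vanishes, as e^z and e^(-z) have equal constant terms. *)
Lemma cauchy_prod_exp_sinhc (R : realType) :
  cauchy_prod (exp_coef (1 : R)) (@sinhc_coef R) =
  (fun k => 2 ^+ k * (k.+1`!)%:R^-1).
Proof.
apply/funext => k.
have sinhE i : (i <= k)%N -> exp_coef 1 i * sinhc_coef R (k - i) =
    2^-1 * (exp_coef 1 i * exp_coef 1 (k.+1 - i)%N
          - exp_coef 1 i * exp_coef (-1) (k.+1 - i)%N).
  move=> ik; rewrite -mulrBr [RHS]mulrCA; congr (_ * _).
  rewrite subSn// /exp_coef /sinhc_coef -mulrBl mulrA; congr (_ / _).
  rewrite expr1n exprS mulN1r opprK -(signr_odd _ (k - i)).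
  by case: odd; rewrite /= ?expr0 ?expr1; field.
have big_conv s : \sum_(0 <= i < k.+1) exp_coef 1 i * exp_coef s (k.+1 - i)%N =
    exp_coef (1 + s) k.+1 - exp_coef 1 k.+1 :> R.
  rewrite -cauchy_prod_exp /cauchy_prod [in RHS]big_nat_recr//= subnn.
  by rewrite /exp_coef expr0 divr1 mulr1 addrK.
rewrite /cauchy_prod; under eq_big_nat => i /andP[_ ik] do rewrite sinhE//.
rewrite -mulr_sumr sumrB !big_conv subrr /exp_coef expr0n mul0r sub0r opprK.
by rewrite addrNK exprS mulrA mulKf.
Qed.

Lemma mx_exp_sinhc (R : realType) n (X : 'M[R]_n) :
  mx_exp X *m mx_sinhc X = mx_phi1 (2 *: X).
Proof.
rewrite -[X in mx_exp X]scale1r mx_expE /mx_phi1 mx_pserZ.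
rewrite -cauchy_prod_exp_sinhc mx_pser_mul//; first exact: entire_exp_coef.
exact: entire_sinhc.
Qed.

(** * Differentials *)

Lemma mulmx_continuous (R : realType) m n p (M : 'M[R]_(m, n)) :
  continuous (fun x : 'M[R]_(n, p) => M *m x).
Proof.
move=> x; apply: (@cvg_mulmx R _ (nbhs x) _ _ _ _ (fun=> M) id M x).
  exact: cvg_cst.
exact: cvg_id.
Qed.

Lemma diff_mulmx (R : realType) (V : normedModType R) m n p
    (M : 'M[R]_(m, n)) (F : V -> 'M[R]_(n, p)) (x : V) : differentiable F x ->
  differentiable (fun y => M *m F y) x /\
  forall v, 'd (fun y => M *m F y) x v = M *m 'd F x v.
Proof.
move=> dF; pose f := mulmx M : {linear 'M[R]_(n, p) -> 'M[R]_(m, p)}.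
have cf : continuous f by exact: mulmx_continuous.
have df := linear_differentiable (F x) cf.
split; first exact: (differentiable_comp dF df).
by move=> v; rewrite [X in X v](diff_comp dF df)/= diff_lin.
Qed.

Lemma diff_jacobi_mx (R : realType) n (F : 'cV[R]_n -> 'cV[R]_n) y v :
  differentiable F y -> 'd F y v = jacobi_mx F y *m v.
Proof.
move=> dF; have jacE i j : jacobi_mx F y i j = ('d F y (delta_mx j 0)) i 0.
  by rewrite mxE /partial -deriveE// derive_mx ?mxE//; exact: diff_derivable.
apply/colP => i; rewrite mxE {1}[v]matrix_sum_delta linear_sum/= summxE.
apply: eq_bigr => j _; rewrite big_ord1 linearZ/= mxE jacE mulrC.
by congr (_ * _).
Qed.

Lemma half_scale_double (R : realType) (V : lmodType R) (x : V) :
  2^-1 *: (x + x) = x.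
Proof. by rewrite -mulr2n -[x *+ 2]scaler_nat scalerA mulVf ?scale1r. Qed.

Lemma is_diff_fst (R : realType) (V W : normedModType R) (z : V * W) :
  is_diff z (@fst V W) fst.
Proof.
have cfst : continuous (@fst V W) by move=> y; exact: cvg_fst.
by apply: DiffDef; [exact: linear_differentiable|exact: diff_lin].
Qed.

Lemma is_diff_snd (R : realType) (V W : normedModType R) (z : V * W) :
  is_diff z (@snd V W) snd.
Proof.
have csnd : continuous (@snd V W) by move=> y; exact: cvg_snd.
by apply: DiffDef; [exact: linear_differentiable|exact: diff_lin].
Qed.

(** Invariance under the swap forces the two partial differentials to agree,
    and restriction to the diagonal adds them; hence each is half of the
    differential of the restriction. *)
Lemma diff_symmetric (R : realType) (V W : normedModType R) (G : V * V -> W)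
    (p : V) : (forall x y, G (x, y) = G (y, x)) -> differentiable G (p, p) ->
  differentiable (fun x => G (x, x)) p /\
  forall u v, 'd G (p, p) (u, v) = 2^-1 *: 'd (fun x => G (x, x)) p (u + v).
Proof.
move=> Gsym dG; have isG : is_diff (p, p) G ('d G (p, p)) by exact: DiffDef.
pose diag (x : V) := (x, x); pose swap (z : V * V) := (z.2, z.1).
have isD : is_diff p (G \o diag) ('d G (p, p) \o diag).
  exact: (is_diff_comp (is_diff_pair (is_diff_id p) (is_diff_id p)) isG).
have isS : is_diff (p, p) (G \o swap) ('d G (p, p) \o swap).
  have isW : is_diff (p, p) swap swap.
    exact: (is_diff_pair (is_diff_snd (p, p)) (is_diff_fst (p, p))).
  exact: (@is_diff_comp _ _ _ _ _ _ G _ (p, p) isW isG).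
have swapE u v : 'd G (p, p) (u, v) = 'd G (p, p) (v, u).
  have GE : G \o swap = G by apply/funext => -[x y]; exact: Gsym.
  rewrite GE in isS.
  exact: (congr1 (fun f : V * V -> W => f (u, v)) (@diff_val _ _ _ _ _ _ _ isS)).
split; first exact: (@ex_diff _ _ _ _ _ _ _ isD).
move=> u v; rewrite [X in _ *: X](_ : _ = 'd G (p, p) (u + v, u + v));
  last first.
  exact: (congr1 (fun f : V -> W => f (u + v)) (@diff_val _ _ _ _ _ _ _ isD)).
have -> : (u + v, u + v) = (u, v) + (v, u) by congr (_, _); rewrite addrC.
by rewrite linearD/= (swapE v u) half_scale_double.
Qed.

Lemma diff_increment_sub (R : realType) (V : normedModType R) (F : V * V -> V)
    (p : V * V) : differentiable F p ->
  differentiable (fun y => y.2 - y.1 - F y) p /\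
  forall u v, 'd (fun y => y.2 - y.1 - F y) p (u, v) = v - u - 'd F p (u, v).
Proof.
move=> dF; have isF : is_diff p F ('d F p) by exact: DiffDef.
have isP := is_diffB (is_diffB (is_diff_snd p) (is_diff_fst p)) isF.
split; first exact: (@ex_diff _ _ _ _ _ _ _ isP).
move=> u v.
exact: (congr1 (fun f : V * V -> V => f (u, v)) (@diff_val _ _ _ _ _ _ _ isP)).
Qed.

(** * The linearized scheme and its exact solution *)

(** Left multiplication by the invertible matrix exp(X) cosh(X) turns the
    residual of the midpoint rule into v minus the exact solution, so that
    both vanish together. *)
Lemma solve_tanhc_midpoint (R : realType) n (X : 'M[R]_n) (F u v : 'cV[R]_n) :
    mx_tanh_defined X ->
  v - u - mx_tanhc X *m (F + X *m (u + v)) = 0 <->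
  v = mx_exp (2 *: X) *m u + mx_phi1 (2 *: X) *m F.
Proof.
rewrite /mx_tanh_defined /mx_tanhc => Cu.
set C := mx_cosh X in Cu *; set K := mx_sinhc X.
pose P := mx_exp X; pose N := mx_exp (- X).
have XE : 1 *: X = X := scale1r X.
have NXE : -1 *: X = - X := scaleN1r X.
have KC : K *m C = C *m K.
  by apply: mx_pser_comm; [exact: entire_sinhc|exact: entire_cosh].
have CKP : C + X *m K = P.
  by have := mx_cosh_add_sinh X false; rewrite expr0 !scale1r.
have CKN : C - X *m K = N.
  by have := mx_cosh_add_sinh X true; rewrite expr1 !scaleN1r.
have KX : K *m X = X *m K by apply: mx_pser_commX; exact: entire_sinhc.
have PN : P *m N = 1%:M.
  by rewrite -(mx_exp0 X) -(subrr 1) -mx_expM XE NXE.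
have PP : P *m P = mx_exp (2 *: X).
  by rewrite -[2]/(1 + 1) -mx_expM XE.
have PK : P *m K = mx_phi1 (2 *: X) := mx_exp_sinhc X.
have CT : C *m (K *m invmx C) = K by rewrite mulmxA -KC mulmxK.
have key : (P *m C) *m (v - u - K *m invmx C *m (F + X *m (u + v))) =
    v - (mx_exp (2 *: X) *m u + mx_phi1 (2 *: X) *m F).
  rewrite -mulmxA mulmxBr mulmxA CT.
  have -> : C *m (v - u) - K *m (F + X *m (u + v)) = N *m v - P *m u - K *m F.
    rewrite -CKN -CKP !mulmxDr mulmxN [K *m (X *m u)]mulmxA KX.
    rewrite [K *m (X *m v)]mulmxA KX !mulmxDl mulNmx.
    move: (C *m u) (C *m v) (_ *m u) (_ *m v) (K *m F) => Cu' Cv Su Sv KF.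
    by apply/colP => i; rewrite !mxE; ring.
  by rewrite !mulmxBr !mulmxA PN PP PK mul1mx opprD addrA.
have PCu : P *m C \in unitmx by rewrite unitmx_mul Cu andbT (mulmx1_unit PN).1.
split=> [E|vE].
  by apply/eqP; rewrite -subr_eq0 -key E mulmx0.
have /eqP := key; rewrite vE subrr => /eqP E.
by rewrite -[LHS](mulKmx PCu) E mulmx0.
Qed.

Theorem proposition4p9 (R : realType) (m : nat) (H : 'cV[R]_(m + m) -> R)
    (dg : 'cV[R]_(m + m) -> 'cV[R]_(m + m) -> 'cV[R]_(m + m))
    (ybar : 'cV[R]_(m + m)) (h : R)
    (H_smooth : smooth H)
    (dg_grad : is_discrete_gradient H dg)
    (dgs_C1 : C1 (fun y : 'cV[R]_(m + m) * 'cV[R]_(m + m) =>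
                    sym_dgrad dg y.1 y.2))
    (h_gt0 : 0 < h)
    (h_small : mx_tanh_defined ((h / 2) *: ham_jacobi H ybar)) :
  locally_exact (ham_field H) h
    (dgrad_scheme (theta_sym h (ham_jacobi H ybar)) (sym_dgrad dg)) ybar.
Proof.
have [dG _] := dgs_C1.
pose G (y : 'cV[R]_(m + m) * 'cV[R]_(m + m)) := sym_dgrad dg y.1 y.2.
have GE y : G (y, y) = gradient H y.
  by rewrite /G /sym_dgrad/= dg_grad.2 half_scale_double.
have Gsym x y : G (x, y) = G (y, x) by rewrite /G /sym_dgrad/= addrC.
have [dgrad diffG] := diff_symmetric Gsym (dG (ybar, ybar)).
rewrite (funext GE : (fun x => G (x, x)) = gradient H) in dgrad diffG.
have hessE v : 'd (gradient H) ybar v = hessian H ybar *m v.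
  rewrite diff_jacobi_mx//; congr (_ *m v); apply/matrixP => i j; rewrite !mxE.
  by congr (partial _ j ybar); apply/funext => z; rewrite mxE.
(* The Jacobi matrix of F is the matrix of its differential, which the chain
   rule gives; its columns are the values on the standard basis. *)
have jacE : jacobi_mx (ham_field H) ybar = ham_jacobi H ybar.
  have [dF diffF] := diff_mulmx (@symp_mx R m) dgrad.
  apply/matrixP => i j.
  suff /colP/(_ i) : col j (jacobi_mx (ham_field H) ybar) =
    col j (ham_jacobi H ybar) by rewrite !mxE.
  by rewrite !colE -(diff_jacobi_mx _ dF) [LHS]diffF hessE mulmxA.
rewrite /locally_exact jacE; set A := ham_jacobi H ybar.
set theta := theta_sym h A.
have [dM diffM] := diff_mulmx (theta *m @symp_mx R m) (dG (ybar, ybar)).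
have [dPhi diffPhi] := diff_increment_sub dM.
split; first exact: dPhi.
move=> nu nu'.
have -> : linearized (dgrad_scheme theta (sym_dgrad dg)) ybar nu nu' =
    nu' - nu - mx_tanhc ((h / 2) *: A) *m (h *: ham_field H ybar +
      ((h / 2) *: A) *m (nu + nu')).
  rewrite /linearized [X in _ + X = _]diffPhi diffM [X in _ *m X]diffG hessE.
  rewrite /dgrad_scheme/= subrr sub0r.
  rewrite -[sym_dgrad dg ybar ybar]/(G (ybar, ybar)) GE.
  rewrite addrCA -opprD; congr (_ - _).
  rewrite /theta /theta_sym /A /ham_jacobi /ham_field.
  move: (mx_tanhc _) (nu + nu') => T w.
  rewrite -!mulmxA -!scalemxAl -!scalemxAr !mulmxDr.
  by rewrite -!scalemxAr !scalerA !mulmxA.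
rewrite solve_tanhc_midpoint// scalerA mulrCA divff// mulr1.
by rewrite -scalemxAr.
Qed.
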